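(* Let $k,d$ be integers with $0<k<d$. Then there is $\varepsilon=\varepsilon(k,d)>0$ such that every $\varepsilon$-net $\mathcal{G}_\varepsilon\subset \mathrm{Gr}(k,d)$ has the following property: there is no polyhedral cone $C\subset\mathbb{R}^d$ such that $U\cap C$ is a $k$-dimensional face of $C$ for every $U\in\mathcal{G}_\varepsilon$.
   Context: $\mathrm{Gr}(k,d)$ is the Grassmannian of $k$-dimensional linear subspaces of $\mathbb{R}^d$. Let $B$ be the Euclidean unit ball centered at the origin. For $U,V\in\mathrm{Gr}(k,d)$, $d(U,V)$ is the Hausdorff distance between $U\cap B$ and $V\cap B$, and the angle between them is $\angle(U,V)=\arcsin(d(U,V))$. An $\varepsilon$-net is a set $\mathcal{G}_\varepsilon\subset\mathrm{Gr}(k,d)$ such that for every $U\in\mathrm{Gr}(k,d)$ there is $V\in\mathcal{G}_\varepsilon$ with $\angle(U,V)<\varepsilon$. A polyhedral cone is an intersection of finitely many closed linear halfspaces. *)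

(* Defs.v *)
From HB Require Import structures.
From mathcomp Require Import all_boot all_order all_algebra.
From mathcomp Require Import all_classical all_reals.
From mathcomp Require Import trigo.
From mathcomp Require Import Rstruct.
Set Implicit Arguments. Unset Strict Implicit. Unset Printing Implicit Defensive.
Import Order.TTheory GRing.Theory Num.Theory.
Local Open Scope classical_set_scope.
Local Open Scope ring_scope.

Section Grassmann.
Variables (R : realType) (d : nat).
Notation vec := 'rV[R]_d.

Definition dotv (x y : vec) : R := (x *m y^T) 0 0.
Definition enorm (x : vec) : R := Num.sqrt (dotv x x).

Definition unit_ball : set vec := [set x | enorm x <= 1].

Definition subsp (U : 'M[R]_d) : set vec := [set x | (x <= U)%MS].

(* Gr(k,d): linear subspaces of dimension k, represented by matrices
   whose row space is the subspace *)
Definition Gr (k : nat) : set 'M[R]_d := [set U | \rank U = k].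

Definition dist_to (x : vec) (B : set vec) : R := inf [set enorm (x - b) | b in B].
Definition hausdorff (A B : set vec) : R :=
  Num.max (sup [set dist_to a B | a in A]) (sup [set dist_to b A | b in B]).

Definition grdist (U V : 'M[R]_d) : R :=
  hausdorff (subsp U `&` unit_ball) (subsp V `&` unit_ball).
Definition grangle (U V : 'M[R]_d) : R := asin (grdist U V).

Definition is_eps_net (k : nat) (eps : R) (G : set 'M[R]_d) : Prop :=
  G `<=` Gr k /\ forall U, Gr k U -> exists2 V, G V & grangle U V < eps.

Definition polyhedral_cone (C : set vec) : Prop :=
  exists (m : nat) (a : 'I_m -> vec), C = [set x | forall i, dotv (a i) x <= 0].

(* face of a (convex polyhedral) cone: intersection with a supporting
   hyperplane through the origin (c = 0 gives C itself) *)
Definition is_face (C F : set vec) : Prop :=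
  exists c : vec, (forall x, C x -> dotv c x <= 0) /\
                  F = C `&` [set x | dotv c x = 0].

(* the (linear = affine, as S contains 0 here) dimension of S is k:
   S contains k linearly independent vectors and lies in their span *)
Definition set_dim (S : set vec) (k : nat) : Prop :=
  exists M : 'M[R]_(k, d),
    [/\ forall i, S (row i M), row_free M & forall x, S x -> (x <= M)%MS].

End Grassmann.

(* Main.v *)
(* Suppose that every line of a subspace [N] meets both [C] and the polar of [C]
   outside 0.  Then [dim N <= 1]: otherwise take orthogonal nonzero [y], [z] in
   [N] and in the polar; some [s (y - z)] with [s <> 0] lies in [C], whence
   [s |y|^2 <= 0 <= s |z|^2], which is absurd.
   It follows that [C] cannot meet all [k]-dimensional subspaces while its polar
   meets all [l]-dimensional ones, if [k + l <= d].  Indeed, let [A], [P] be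
   orthogonal subspaces avoiding [C], resp. its polar, of maximal total dimension.
   Then [dim A < k] and [dim P < l], so the orthogonal [N] of [A + P] has
   dimension at least 2, while by maximality all lines of [N] meet the two sets
   [N ∩ (C + A)] and [N ∩ (C° + P)], which are again polar to each other.
   By compactness (an ultrafilter limit of counterexamples) the same holds for
   subspaces met up to a small angle.  Now if [V ∩ C] is a face of [C] of
   dimension [dim V < d], then [C] meets [V] and the polar of [C], which contains
   the normal of the face, meets the orthogonal of [V]; an [eps]-net of such [V]
   comes close to every [k]-dimensional subspace. *)
Require Import Defs.
From HB Require Import structures.
From mathcomp Require Import all_boot all_order all_algebra.
From mathcomp Require Import all_classical all_reals.
From mathcomp Require Import topology normedtype sequences realfun trigo.
From mathcomp Require Import lra zify.
From mathcomp Require Import Rstruct.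

Set Implicit Arguments.
Unset Strict Implicit.
Unset Printing Implicit Defensive.

Import Order.TTheory GRing.Theory Num.Theory.
Import numFieldNormedType.Exports.
Local Open Scope classical_set_scope.
Local Open Scope ring_scope.

Section DotProduct.
Context {R : realType} {d : nat}.
Implicit Types (x y z u v : 'rV[R]_d) (c : R).

Lemma dotvE x y : dotv x y = \sum_j x 0 j * y 0 j.
Proof. by rewrite /dotv mxE; apply: eq_bigr => j _; rewrite mxE. Qed.

Lemma dotvC x y : dotv x y = dotv y x.
Proof. by rewrite !dotvE; apply: eq_bigr => j _; rewrite mulrC. Qed.

Lemma dotv_is_bilinear :
  bilinear_for (GRing.Scale.Law.clone _ _ *%R _)
    (GRing.Scale.Law.clone _ _ *%R _) (@dotv R d).
Proof.
have dotv_scalar z : scalar (fun x => dotv x z).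
  by move=> c x y; rewrite /dotv mulmxDl -scalemxAl !mxE.
by split=> [z|z c x y] //; rewrite ![dotv z _]dotvC; exact: dotv_scalar.
Qed.

HB.instance Definition _ :=
  bilinear_isBilinear.Build R _ _ R *%R *%R (@dotv R d)
    dotv_is_bilinear.

Lemma dotv_ge0 x : 0 <= dotv x x.
Proof. by rewrite dotvE sumr_ge0 // => j _; rewrite -expr2 sqr_ge0. Qed.

Lemma dotv_eq0 x : (dotv x x == 0) = (x == 0).
Proof.
apply/eqP/eqP => [|->]; last exact: linear0l.
rewrite dotvE => /eqP; rewrite psumr_eq0 => [/allP x0|j _]; last first.
  by rewrite -expr2 sqr_ge0.
apply/rowP => j; rewrite mxE; apply/eqP.
by have := x0 j (mem_index_enum j); rewrite /= mulf_eq0 orbb.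
Qed.

Lemma dotv_gt0 x : (0 < dotv x x) = (x != 0).
Proof. by rewrite lt_def dotv_eq0 dotv_ge0 andbT. Qed.

Lemma enorm_ge0 x : 0 <= enorm x.
Proof. exact: sqrtr_ge0. Qed.

Lemma sqr_enorm x : enorm x ^+ 2 = dotv x x.
Proof. by rewrite sqr_sqrtr // dotv_ge0. Qed.

Lemma enorm0 : enorm (0 : 'rV[R]_d) = 0.
Proof. by rewrite /enorm linear0l sqrtr0. Qed.

Lemma enorm_gt0 x : (0 < enorm x) = (x != 0).
Proof. by rewrite sqrtr_gt0 dotv_gt0. Qed.

Lemma enormZ c x : enorm (c *: x) = `|c| * enorm x.
Proof.
rewrite /enorm linearZl_LR linearZr_LR /= mulrA -expr2.
by rewrite sqrtrM ?sqr_ge0 // sqrtr_sqr.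
Qed.

Lemma cauchy_schwarz x y : `|dotv x y| <= enorm x * enorm y.
Proof.
have [->|] := eqVneq y 0; first by rewrite linear0r normr0 mulr_ge0 ?enorm_ge0.
rewrite -dotv_gt0 => yy_gt0.
rewrite -(@ler_pXn2r _ 2) ?nnegrE ?mulr_ge0 ?enorm_ge0 //.
rewrite real_normK ?num_real // exprMn !sqr_enorm.
have := dotv_ge0 (dotv y y *: x - dotv x y *: y).
rewrite linearBl !linearBr !linearZl_LR !linearZr_LR /= (dotvC y x) => sq_ge0.
rewrite -subr_ge0 -(pmulr_rge0 _ yy_gt0); lra.
Qed.

Lemma normr_coord_le_enorm x j : `|x 0 j| <= enorm x.
Proof.
rewrite -(@ler_pXn2r _ 2) ?nnegrE ?enorm_ge0 //.
rewrite real_normK ?num_real // sqr_enorm dotvE (bigD1 j) //= expr2 lerDl.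
by rewrite sumr_ge0 // => i _; rewrite -expr2 sqr_ge0.
Qed.

Definition normalize x := (enorm x)^-1 *: x.

Lemma enorm_normalize x : x != 0 -> enorm (normalize x) = 1.
Proof.
rewrite -enorm_gt0 => x_gt0.
by rewrite enormZ gtr0_norm ?invr_gt0 // mulVf ?gt_eqF.
Qed.

End DotProduct.

Section OrthogonalComplement.
Context {R : realType} {d : nat}.
Implicit Types (x y n : 'rV[R]_d).

Definition orthmx m (A : 'M[R]_(m, d)) : 'M[R]_d := kermx A^T.

Lemma sub_orthmx m p (A : 'M[R]_(m, d)) (B : 'M[R]_(p, d)) :
  (A <= orthmx B)%MS = (A *m B^T == 0).
Proof. exact: (sameP sub_kermxP eqP). Qed.

Lemma sub_orthmxC m p (A : 'M[R]_(m, d)) (B : 'M[R]_(p, d)) :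
  (A <= orthmx B)%MS = (B <= orthmx A)%MS.
Proof. by rewrite !sub_orthmx -trmx_eq0 trmx_mul trmxK. Qed.

Lemma sub_orthmx_dotv x y : (x <= orthmx y)%MS = (dotv x y == 0).
Proof.
rewrite sub_orthmx /dotv; apply/eqP/eqP => [->|xy0]; first by rewrite mxE.
by apply/rowP => i; rewrite ord1 xy0 mxE.
Qed.

Lemma dotv_orthmx m p (A : 'M[R]_(m, d)) (B : 'M[R]_(p, d)) x y :
  (A <= orthmx B)%MS -> (x <= A)%MS -> (y <= B)%MS -> dotv x y = 0.
Proof.
move=> AB xA yB; apply/eqP; rewrite -sub_orthmx_dotv.
rewrite sub_orthmxC (submx_trans yB) // sub_orthmxC.
exact: submx_trans AB.
Qed.

Lemma sub_orthmxP m (B : 'M[R]_(m, d)) x :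
  reflect (forall y, (y <= B)%MS -> dotv x y = 0) (x <= orthmx B)%MS.
Proof.
apply: (iffP idP) => [xB y|xB]; first exact: dotv_orthmx xB _.
rewrite sub_orthmxC; apply/row_subP => i.
by rewrite sub_orthmxC sub_orthmx_dotv xB ?row_sub.
Qed.

Lemma sub_orthmx_adds m p q (A : 'M[R]_(m, d)) (B : 'M[R]_(p, d))
    (C : 'M[R]_(q, d)) :
  (C <= orthmx (A + B)%MS)%MS = (C <= orthmx A)%MS && (C <= orthmx B)%MS.
Proof. by rewrite sub_orthmxC addsmx_sub !(sub_orthmxC _ C). Qed.

Lemma mxrank_orthmx m (A : 'M[R]_(m, d)) : \rank (orthmx A) = (d - \rank A)%N.
Proof. by rewrite mxrank_ker mxrank_tr. Qed.

Lemma orthmxK m (A : 'M[R]_(m, d)) : (orthmx (orthmx A) :=: A)%MS.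
Proof.
have A_sub : (A <= orthmx (orthmx A))%MS by rewrite sub_orthmxC.
apply/eqmx_sym/eqmxP; rewrite -(geq_leqif (mxrank_leqif_eq A_sub)).
by rewrite !mxrank_orthmx subKn // rank_leq_col.
Qed.

Lemma mxrank_adds_orth_rV m (A : 'M[R]_(m, d)) n :
  n != 0 -> (n <= orthmx A)%MS -> \rank (A + n)%MS = (\rank A).+1.
Proof.
move=> n0 nA; rewrite mxrank_disjoint_sum ?rank_rV ?n0 ?addn1 //.
apply/eqP/rowV0P => v; rewrite sub_capmx => /andP[vA vn].
by apply/eqP; rewrite -dotv_eq0 (dotv_orthmx nA vn vA).
Qed.

End OrthogonalComplement.

Lemma exists_submx_rank (F : fieldType) m n (A : 'M[F]_(m, n)) k :
  (k <= \rank A)%N -> exists2 U : 'M[F]_n, (U <= A)%MS & \rank U = k.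
Proof.
move=> kA; exists (pid_mx k *m row_base A).
  by rewrite (submx_trans (submxMl _ _)) ?eq_row_base.
rewrite mxrankMfree ?row_base_free // rank_pid_mx //.
exact: leq_trans kA (rank_leq_col A).
Qed.

Section Polarity.
Context {R : realType} {d : nat}.
Implicit Types (x y n : 'rV[R]_d) (C D : set 'rV[R]_d).

Definition polar C : set 'rV[R]_d := [set y | forall x, C x -> dotv y x <= 0].

Definition meets C m (U : 'M[R]_(m, d)) : Prop :=
  exists x, [/\ C x, x != 0 & (x <= U)%MS].

Lemma meetsS C D m p (U : 'M[R]_(m, d)) (V : 'M[R]_(p, d)) :
  C `<=` D -> (U <= V)%MS -> meets C U -> meets D V.
Proof.
by move=> CD UV [x [/CD Dx x0 xU]]; exists x; split=> //; exact: submx_trans UV.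
Qed.

Lemma meets0 C m : ~ meets C (0 : 'M[R]_(m, d)).
Proof. by move=> [x [_ /eqP x0 /submx0null]]. Qed.

Lemma meets_rank_ge C k m (A : 'M[R]_(m, d)) :
  (forall U : 'M_d, \rank U = k -> meets C U) -> (k <= \rank A)%N -> meets C A.
Proof.
move=> meetsC /exists_submx_rank[U UA /meetsC]; exact: meetsS.
Qed.

Lemma polar_meets_lines_rank_le1 C m (N : 'M[R]_(m, d)) :
    (forall n, n != 0 -> (n <= N)%MS -> meets C n) ->
    (forall n, n != 0 -> (n <= N)%MS -> meets (polar C) n) ->
  (\rank N <= 1)%N.
Proof.
move=> meetsC meetsP; rewrite leqNgt; apply/negP => N_gt1.
have /rowV0Pn[e eN e0] : N != 0 by rewrite -mxrank_eq0 -lt0n ltnW.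
have [y [Cy y0 /submx_trans/(_ eN) yN]] := meetsP e e0 eN.
have /rowV0Pn[f fNy f0] : (N :&: orthmx y)%MS != 0.
  rewrite -mxrank_eq0 -lt0n; have := mxrank_sum_cap N (orthmx y).
  rewrite mxrank_orthmx rank_rV y0.
  have := rank_leq_col (N + orthmx y)%MS; lia.
move: fNy; rewrite sub_capmx => /andP[fN fy].
have [z [Cz z0 zf]] := meetsP f f0 fN.
have zN := submx_trans zf fN.
have /eqP zy : dotv z y == 0 by rewrite -sub_orthmx_dotv (submx_trans zf).
have {y0} yy : 0 < dotv y y by rewrite dotv_gt0.
have {z0} zz : 0 < dotv z z by rewrite dotv_gt0.
have yz0 : y - z != 0.
  by rewrite -dotv_gt0 linearBl !linearBr /= (dotvC y z) zy; lra.
have yzN : (y - z <= N)%MS by rewrite addmx_sub ?eqmx_opp.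
have [x [Cx x0 /sub_rVP[s xE]]] := meetsC _ yz0 yzN.
have := Cy x Cx; have := Cz x Cx.
rewrite xE !linearZr_LR !linearBr /= (dotvC y z) zy sub0r subr0.
rewrite mulrN oppr_le0 pmulr_lge0 // pmulr_lle0 // => s_ge0 s_le0.
by move: x0; rewrite xE (@le_anti _ _ s 0) ?scale0r ?eqxx // s_le0.
Qed.

Definition shadow C m (A : 'M[R]_(m, d)) p (N : 'M[R]_(p, d)) :
    set 'rV[R]_d :=
  [set n | (n <= N)%MS /\ exists2 a, (a <= A)%MS & C (a + n)].

Lemma shadow_polar C m p q (A : 'M[R]_(m, d)) (P : 'M[R]_(p, d))
    (N : 'M[R]_(q, d)) :
    (A <= orthmx P)%MS -> (N <= orthmx (A + P)%MS)%MS ->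
  shadow (polar C) P N `<=` polar (shadow C A N).
Proof.
rewrite sub_orthmx_adds => AP /andP[NA NP] y [yN [b bP Cby]] x [xN [a aA Cax]].
have := Cby _ Cax; rewrite linearDl !linearDr /=.
rewrite (dotvC b a) (dotv_orthmx AP aA bP) (dotv_orthmx NA yN aA).
by rewrite (dotvC b x) (dotv_orthmx NP xN bP) !add0r.
Qed.

Lemma meets_shadow C m p (A : 'M[R]_(m, d)) (N : 'M[R]_(p, d)) n :
  ~ meets C A -> meets C (A + n)%MS -> (n <= N)%MS -> meets (shadow C A N) n.
Proof.
move=> CA [x [Cx x0 /sub_addsmxP[[u v] /= xE]]] nN.
exists (v *m n); split; rewrite ?submxMl //.
- split; first exact: submx_trans (submxMl _ _) nN.
  by exists (u *m A); rewrite ?submxMl -?xE.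
- apply: contra_notN CA => /eqP vn0; exists x; split=> //.
  by rewrite xE vn0 addr0 submxMl.
Qed.

Definition orth_avoiding C D m p (A : 'M[R]_(m, d)) (P : 'M[R]_(p, d)) : Prop :=
  [/\ (A <= orthmx P)%MS, ~ meets C A & ~ meets D P].

Lemma exists_maximal_orth_avoiding C D : exists A P : 'M[R]_d,
  orth_avoiding C D A P /\
  forall n, n != 0 -> (n <= orthmx (A + P)%MS)%MS ->
    meets C (A + n)%MS /\ meets D (P + n)%MS.
Proof.
pose total_rank r := `[< exists A P : 'M[R]_d,
  orth_avoiding C D A P /\ (\rank A + \rank P)%N = r >].
have ex_total_rank : exists r, total_rank r.
  exists 0%N; apply/asboolP; exists 0, 0.
  by rewrite mxrank0; split=> //; split; rewrite ?sub0mx //; exact: meets0.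
have total_rank_le r : total_rank r -> (r <= d + d)%N.
  by move=> /asboolP[A [P [_ <-]]]; rewrite leq_add ?rank_leq_col.
have [r /asboolP[A [P [APavoid <-]]] r_max] :=
  ex_maxnP ex_total_rank total_rank_le.
have rank_max (A' P' : 'M[R]_d) : orth_avoiding C D A' P' ->
    (\rank A' + \rank P' <= \rank A + \rank P)%N.
  by move=> avoid; apply/r_max/asboolP; exists A', P'.
exists A, P; split=> // n n0; rewrite sub_orthmx_adds => /andP[nA nP].
have [AP CA DP] := APavoid; split; apply: contrapT => avoid.
- have /rank_max : orth_avoiding C D (A + n)%MS P.
    by split=> //; rewrite addsmx_sub AP.
  by rewrite mxrank_adds_orth_rV // addSn ltnn.
- have /rank_max : orth_avoiding C D A (P + n)%MS.
    by split=> //; rewrite sub_orthmx_adds AP sub_orthmxC.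
  by rewrite mxrank_adds_orth_rV // addnS ltnn.
Qed.

Lemma polar_not_meets_all k l C : (k + l <= d)%N ->
    (forall U : 'M_d, \rank U = k -> meets C U) ->
  ~ (forall W : 'M_d, \rank W = l -> meets (polar C) W).
Proof.
move=> kld meetsC meetsP.
have [A [P [[AP CA PP] extend]]] := exists_maximal_orth_avoiding C (polar C).
set N := orthmx (A + P)%MS in extend.
have A_lt : (\rank A < k)%N.
  by rewrite ltnNge; apply: contra_notN CA; exact: meets_rank_ge.
have P_lt : (\rank P < l)%N.
  by rewrite ltnNge; apply: contra_notN PP; exact: meets_rank_ge.
have : (\rank N <= 1)%N.
  apply: (@polar_meets_lines_rank_le1 (shadow C A N)) => n n0 nN.
  - by apply: meets_shadow => //; have [] := extend n n0 nN.
  - apply: (meetsS (shadow_polar AP (submx_refl N)) (submx_refl n)).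
    by apply: meets_shadow => //; have [] := extend n n0 nN.
rewrite mxrank_orthmx; have [+ _] := mxrank_adds_leqif A P; lia.
Qed.

End Polarity.

Lemma ultra_compact_cvg (T : Type) (X : topologicalType) (F : set_system T)
    (K : set X) (u : T -> X) :
  UltraFilter F -> compact K -> (forall t, K (u t)) ->
  exists2 p, K p & u @ F --> p.
Proof.
move=> FU Kcompact Ku; have FP : ProperFilter F by exact: ultra_proper.
have [p [Kp clp]] := Kcompact (u @ F) _ (@filterE _ F _ _ Ku).
exists p => // B pB; have [//|FnB] := in_ultra_setVsetC (u @^-1` B) FU.
by have [y [nBy /nBy]] := clp (~` B) B FnB pB.
Qed.

Section Limits.
Context {R : realType} {d : nat}.
Implicit Types (x y z : 'rV[R]_d) (C : set 'rV[R]_d).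

Lemma cvg_dotv (T : Type) (F : set_system T) {FF : Filter F}
    (u v : T -> 'rV[R]_d) x y :
  u @ F --> x -> v @ F --> y -> dotv (u t) (v t) @[t --> F] --> dotv x y.
Proof.
move=> ux vy; rewrite dotvE; under eq_fun do rewrite dotvE.
apply: cvg_big => [|j _]; first exact: add_continuous.
by apply: cvgM; apply: (continuous_cvg _ (@coord_continuous _ _ _ _ _ _)).
Qed.

Lemma continuous_enorm : continuous (@enorm R d).
Proof.
move=> x; apply: (@continuous_comp _ _ _ (fun x => dotv x x) Num.sqrt).
  exact: (cvg_dotv (FF := nbhs_filter x) cvg_id cvg_id).
exact: sqrt_continuous.
Qed.

Lemma compact_unit_sphere : compact [set x : 'rV[R]_d | enorm x = 1].
Proof.
have cube_compact := @rV_compact R d _ (fun=> @segment_compact R (-1) 1).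
apply: subclosed_compact cube_compact _ => [|x x1 i].
- apply: (@preimage_closed _ _ (@enorm R d) [set r | r = 1]) => [x _|].
    exact: continuous_enorm.
  exact: closed_eq.
- by rewrite /= in_itv /= -ler_norml -x1 normr_coord_le_enorm.
Qed.

Definition nearly_meets (delta : R) C m (U : 'M[R]_(m, d)) : Prop :=
  exists x, [/\ C x, x != 0 & forall z, (z <= orthmx U)%MS ->
    `|dotv x z| <= delta * (enorm x * enorm z)].

Definition limit_directions (F : set_system nat) (C_ : nat -> set 'rV[R]_d) :
    set 'rV[R]_d :=
  [set x | exists2 u, forall n, C_ n (u n) & normalize (u n) @[n --> F] --> x].

Lemma limit_directions_polar (F : set_system nat) {FF : ProperFilter F}
    (C_ : nat -> set 'rV[R]_d) :
  limit_directions F (polar \o C_) `<=` polar (limit_directions F C_).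
Proof.
move=> y [v Cv vy] x [u Cu ux]; apply: (cvgr_to_le (cvg_dotv vy ux)).
apply: nearW => n; rewrite linearZl_LR linearZr_LR /=.
by rewrite !mulr_ge0_le0 ?invr_ge0 ?enorm_ge0 //; exact: Cv.
Qed.

Lemma meets_limit_directions (F : set_system nat) (delta : nat -> R)
    (C_ : nat -> set 'rV[R]_d) m (U : 'M[R]_(m, d)) :
    UltraFilter F -> delta @ F --> 0 ->
    (forall n, nearly_meets (delta n) (C_ n) U) ->
  meets (limit_directions F C_) U.
Proof.
move=> FU delta0 /choice[u uP].
have FP : ProperFilter F by exact: ultra_proper.
have [x x1 ux] : exists2 x, enorm x = 1 & normalize (u n) @[n --> F] --> x.
  apply: ultra_compact_cvg compact_unit_sphere _ => n.
  by apply: enorm_normalize; have [] := uP n.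
exists x; split; first by exists u => // n; have [] := uP n.
  by rewrite -enorm_gt0 x1.
rewrite -(orthmxK U); apply/sub_orthmxP => z zU; apply/eqP; rewrite -normr_le0.
have dotv_lim : `|dotv (normalize (u n)) z| @[n --> F] --> `|dotv x z|.
  exact: cvg_norm (cvg_dotv ux (cvg_cst z)).
have bound_lim : delta n * enorm z @[n --> F] --> 0 * enorm z.
  exact: cvgM delta0 (cvg_cst _).
rewrite -(mul0r (enorm z)); apply: (ler_cvg_to dotv_lim bound_lim).
apply: nearW => n; have [_ un0 /(_ z zU) unz] := uP n.
rewrite linearZl_LR /= normrM normfV (ger0_norm (enorm_ge0 _)) mulrC.
by rewrite ler_pdivrMr ?enorm_gt0 // -mulrA (mulrC (enorm z)).
Qed.

Lemma polar_not_nearly_meets_all k l : (k + l <= d)%N ->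
  exists2 delta : R, 0 < delta <= 1 & forall C,
    (forall U : 'M_d, \rank U = k -> nearly_meets delta C U) ->
    ~ (forall W : 'M_d, \rank W = l -> nearly_meets delta (polar C) W).
Proof.
move=> kld; apply: contrapT => /forall2NP no_delta.
have /choice[C_ CP] (n : nat) : exists C : set 'rV[R]_d,
    (forall U : 'M_d, \rank U = k -> nearly_meets (harmonic n) C U) /\
    (forall W : 'M_d, \rank W = l -> nearly_meets (harmonic n) (polar C) W).
  have [/negP|/existsNP[C /not_implyP[meetsC /contrapT meetsP]]] :=
    no_delta (harmonic n); last by exists C.
  by rewrite harmonic_gt0 invf_le1 ?ltr0n ?ler1n.
have [F [FU ooF]] := ultraFilterLemma (_ : ProperFilter \oo).
have FP : ProperFilter F by exact: ultra_proper.
have harmonicF : @harmonic R @ F --> 0.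
  exact: cvg_trans (cvg_app _ ooF) cvg_harmonic.
apply: (polar_not_meets_all (C := limit_directions F C_) kld) => [U rU|W rW].
- by apply: meets_limit_directions harmonicF _ => n; exact: (CP n).1.
- apply: meetsS (@limit_directions_polar F FP C_) (submx_refl W) _.
  by apply: meets_limit_directions harmonicF _ => n; exact: (CP n).2.
Qed.

End Limits.

Lemma ltr_asin (R : realType) :
  {in `[-1, 1] &, {mono @asin R : s t / s < t}}.
Proof.
move=> s t s1 t1; rewrite -{2}(asinK s1) -{2}(asinK t1).
by rewrite ltr_sin // in_itv /= asin_geNpi2 ?asin_lepi2.
Qed.

Lemma asin0 (R : realType) : asin 0 = 0 :> R.
Proof.
by rewrite -[in LHS]sin0 sinK // in_itv /= oppr_le0 divr_ge0 ?pi_ge0.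
Qed.

Lemma asin_gt0 (R : realType) (t : R) : 0 < t <= 1 -> 0 < asin t.
Proof.
by move=> t01; rewrite -[ltLHS]asin0 ltr_asin ?in_itv /=; lra.
Qed.

Section GrassmannDistance.
Context {R : realType} {d : nat}.
Implicit Types (x z w : 'rV[R]_d) (A B C : set 'rV[R]_d) (U V W : 'M[R]_d).

Lemma dist_to_ge0 x A : A !=set0 -> 0 <= dist_to x A.
Proof.
move=> [a Aa]; apply: lb_le_inf; first by exists (enorm (x - a)), a.
by move=> _ [b _ <-]; exact: enorm_ge0.
Qed.

Lemma dist_to_le x A a : A a -> dist_to x A <= enorm (x - a).
Proof.
move=> Aa; apply: ge_inf; last by exists a.
by exists 0 => _ [b _ <-]; exact: enorm_ge0.
Qed.

Lemma normr_dotv_le_dist_to z w A :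
    A !=set0 -> (forall a, A a -> dotv a w = 0) ->
  `|dotv z w| <= dist_to z A * enorm w.
Proof.
move=> [a Aa] Aw; have [->|] := eqVneq w 0.
  by rewrite linear0r normr0 enorm0 mulr0.
rewrite -enorm_gt0 => w_gt0; rewrite -ler_pdivrMr //.
apply: lb_le_inf => [|_ [b Ab <-]]; first by exists (enorm (z - a)), a.
rewrite ler_pdivrMr //; apply: le_trans (cauchy_schwarz _ _).
by rewrite linearBl /= (Aw b Ab) subr0.
Qed.

Lemma dist_to_le1 x A : A 0 -> unit_ball x -> dist_to x A <= 1.
Proof.
by move=> A0 x1; apply: le_trans (dist_to_le x A0) _; rewrite subr0.
Qed.

Lemma dist_to_le_hausdorff A B a :
  A `<=` @unit_ball R d -> B 0 -> A a -> dist_to a B <= hausdorff A B.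
Proof.
move=> A1 B0 Aa; rewrite /hausdorff le_max; apply/orP; left.
apply: ub_le_sup; last by exists a.
by exists 1 => _ [b Ab <-]; exact: dist_to_le1 (A1 b Ab).
Qed.

Lemma sup_dist_to_le1 A B : A `<=` @unit_ball R d -> A !=set0 -> B 0 ->
  sup [set dist_to a B | a in A] <= 1.
Proof.
move=> A1 [a Aa] B0; apply: ge_sup => [|_ [b Ab <-]].
  by exists (dist_to a B), a.
exact: dist_to_le1 (A1 b Ab).
Qed.

Lemma grdistC U V : grdist U V = grdist V U.
Proof. exact: maxC. Qed.

Lemma subsp_ball0 U : (subsp U `&` @unit_ball R d) 0.
Proof. by split; [exact: sub0mx|rewrite /unit_ball /= enorm0 ler01]. Qed.

Lemma grdist_ge0_le1 U V : 0 <= grdist U V <= 1.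
Proof.
have [U0 V0] := (subsp_ball0 U, subsp_ball0 V).
have ball_sub W := @subIsetr _ (subsp W) (@unit_ball R d).
apply/andP; split.
- apply: le_trans (dist_to_le_hausdorff (ball_sub U) V0 U0).
  by apply: dist_to_ge0; exists 0.
- rewrite ge_max; apply/andP.
  by split; apply: sup_dist_to_le1 => //; exists 0.
Qed.

Lemma grdist_lt_asin U V (delta : R) :
  0 < delta <= 1 -> grangle U V < asin delta -> grdist U V < delta.
Proof.
move=> delta01; have dist01 := grdist_ge0_le1 U V.
by rewrite /grangle ltr_asin ?in_itv //=; lra.
Qed.

Lemma normr_dotv_le_grdist U V z w : (z <= U)%MS -> (w <= orthmx V)%MS ->
  `|dotv z w| <= grdist U V * (enorm z * enorm w).
Proof.
move=> zU wV; have [->|z0] := eqVneq z 0.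
  by rewrite linear0l normr0 enorm0 mul0r mulr0.
have zU1 : (subsp U `&` @unit_ball R d) (normalize z).
  by split; [exact: scalemx_sub|rewrite /unit_ball /= enorm_normalize].
have dist_le : dist_to (normalize z) (subsp V `&` @unit_ball R d) <= grdist U V.
  by apply: dist_to_le_hausdorff (subsp_ball0 V) zU1 => x [].
have -> : dotv z w = enorm z * dotv (normalize z) w.
  by rewrite linearZl_LR /= mulVKf // gt_eqF // enorm_gt0.
rewrite normrM ger0_norm ?enorm_ge0 // mulrCA ler_wpM2l ?enorm_ge0 //.
apply: le_trans (ler_wpM2r (enorm_ge0 w) dist_le).
apply: normr_dotv_le_dist_to => [|v [vV _]].
  by exists 0; exact: subsp_ball0.
by rewrite dotvC (dotv_orthmx wV).
Qed.

Lemma nearly_meets_grdist (delta : R) C U V :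
  meets C V -> grdist U V <= delta -> nearly_meets delta C U.
Proof.
move=> [x [Cx x0 xV]] UV; exists x; split=> // z zU.
apply: le_trans (normr_dotv_le_grdist xV zU) _.
by rewrite grdistC ler_wpM2r ?mulr_ge0 ?enorm_ge0.
Qed.

Lemma nearly_meets_orthmx_grdist (delta : R) C V W :
  meets C (orthmx V) -> grdist (orthmx W) V <= delta -> nearly_meets delta C W.
Proof.
move=> [x [Cx x0 xV]] WV; exists x; split=> // z zW.
rewrite dotvC (mulrC (enorm x)).
apply: le_trans (normr_dotv_le_grdist zW xV) _.
by rewrite ler_wpM2r ?mulr_ge0 ?enorm_ge0.
Qed.

End GrassmannDistance.

Section Faces.
Context {R : realType} {d : nat}.
Implicit Types (c : 'rV[R]_d) (C S : set 'rV[R]_d) (U : 'M[R]_d).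

Lemma meets_set_dim C U k :
  (0 < k)%N -> set_dim (subsp U `&` C) k -> meets C U.
Proof.
move=> k0 [M [MS Mfree _]]; have [MU MC] := MS (Ordinal k0).
exists (row (Ordinal k0) M); split=> //.
by rewrite rowE mulmx_free_eq0 // -mxrank_eq0 mxrank_delta.
Qed.

Lemma sub_orthmx_set_dim S U c :
    S `<=` subsp U -> set_dim S (\rank U) -> (forall x, S x -> dotv c x = 0) ->
  (c <= orthmx U)%MS.
Proof.
move=> SU [M [MS Mfree _]] cS.
have MU : (M <= U)%MS by apply/row_subP => i; exact: SU (MS i).
have UM : (U <= M)%MS by rewrite -(geq_leqif (mxrank_leqif_sup MU)) (eqP Mfree).
rewrite sub_orthmxC (submx_trans UM) //; apply/row_subP => i.
by rewrite sub_orthmxC sub_orthmx_dotv cS.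
Qed.

Lemma meets_polar_face C U :
    (\rank U < d)%N -> is_face C (subsp U `&` C) ->
    set_dim (subsp U `&` C) (\rank U) ->
  meets (polar C) (orthmx U).
Proof.
move=> Ud [c [c_polar faceE]] dimF; have [c0|c0] := eqVneq c 0.
(* The normal may be 0; then the face is [C] itself, so that [C] lies in [U]. *)
- have /rowV0Pn[y yU y0] : orthmx U != 0.
    by rewrite -mxrank_eq0 mxrank_orthmx subn_eq0 -ltnNge.
  exists y; split=> // x Cx.
  have [xU _] : (subsp U `&` C) x.
    by rewrite faceE; split; rewrite //= c0 linear0l.
  by rewrite (dotv_orthmx yU).
- exists c; split=> //; apply: sub_orthmx_set_dim dimF _ => [x []//|x].
  by rewrite faceE => -[].
Qed.

End Faces.

Theorem theorem2p2 (k d : nat) (hk : (0 < k)%N) (hkd : (k < d)%N) :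
  exists eps : Rdefinitions.R, 0 < eps /\
    forall G : set 'M[Rdefinitions.R]_d,
      is_eps_net k eps G ->
      ~ (exists C : set 'rV[Rdefinitions.R]_d,
           polyhedral_cone C /\
           forall U, G U ->
             is_face C (subsp U `&` C) /\ set_dim (subsp U `&` C) k).
Proof.
have kd := ltnW hkd.
have [delta delta01 no_cone] :=
  @polar_not_nearly_meets_all Rdefinitions.R d _ _ (eq_leq (subnKC kd)).
exists (asin delta); split; first exact: asin_gt0.
move=> G [Gk net] [C [_ faces]].
have netP U : \rank U = k -> exists V,
    [/\ meets C V, meets (polar C) (orthmx V) & grdist U V <= delta].
  move=> /net[V GV UV]; have [Vface Vdim] := faces V GV; have rV := Gk V GV.
  exists V; split; last exact/ltW/grdist_lt_asin.
  - exact: meets_set_dim Vdim.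
  - by apply: meets_polar_face; rewrite ?rV.
apply: (no_cone C) => [U rU|W rW].
- by have [V [CV _]] := netP U rU; exact: nearly_meets_grdist.
- have /netP[V [_ CV]] : \rank (orthmx W) = k by rewrite mxrank_orthmx rW subKn.
  exact: nearly_meets_orthmx_grdist.
Qed.
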